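(* For every integer $t>0$, the graph $B_{2t}$ is not unmixed.
   Context: For an integer $t\ge 1$, $B_{2t}$ is the simple graph with vertex set $\{v_1,\dots,v_{3t+3}\}$ and edge set $\{\{v_i,v_{i+1}\} : 1\le i\le 3t+2,\ i\ne t+1,\ i\neq 2t+2\}\cup\{\{v_i,v_{i+t+1}\} : 1\le i\le 2t+2\}$ (a grid of unit squares with 2 rows and $t$ columns of squares). A vertex cover of a graph is a set of vertices such that every edge is incident with at least one vertex of the set; it is minimal if no proper subset is a vertex cover. A graph is unmixed if all its minimal vertex covers have the same cardinality. *)

(* Defs.v *)
From mathcomp Require Import all_boot.
From mathcomp Require Import zify.
Set Implicit Arguments.
Unset Strict Implicit.
Unset Printing Implicit Defensive.

Record sgraph := SGraph {
  vertex :> finType;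
  adj : rel vertex;
  adj_sym : symmetric adj;
  adj_irrefl : irreflexive adj
}.

Definition vertex_cover (G : sgraph) (C : {set G}) : bool :=
  [forall u : G, forall v : G, adj u v ==> (u \in C) || (v \in C)].

Definition minimal_vertex_cover (G : sgraph) (C : {set G}) : bool :=
  minset (@vertex_cover G) C.

Definition unmixed (G : sgraph) : Prop :=
  forall C D : {set G},
    minimal_vertex_cover C -> minimal_vertex_cover D -> #|C| = #|D|.

(* The ordinal u stands for the vertex v_(u+1); i and j are 1-based labels. *)
Definition B2_arc (t : nat) (u v : 'I_(3 * t + 3)) : bool :=
  let i := u.+1 in let j := v.+1 in
  [&& 1 <= i <= 3 * t + 2, i != t + 1, i != 2 * t + 2 & j == i + 1]
  || (1 <= i <= 2 * t + 2) && (j == i + t + 1).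

Definition B2_adj (t : nat) : rel 'I_(3 * t + 3) :=
  fun u v => B2_arc u v || B2_arc v u.

Lemma B2_adj_sym (t : nat) : symmetric (@B2_adj t).
Proof. by move=> u v; rewrite /B2_adj orbC. Qed.

Lemma B2_adj_irrefl (t : nat) : irreflexive (@B2_adj t).
Proof. by move=> u; rewrite /B2_adj /B2_arc; lia. Qed.

Definition B2 (t : nat) : sgraph :=
  SGraph (@B2_adj_sym t) (@B2_adj_irrefl t).

(* Main.v *)
Require Import Defs.
From mathcomp Require Import all_boot.
From mathcomp Require Import zify.

(** View [B2 t] as the grid with rows [0, 1, 2] and columns [0, ..., t]. The
    cells [(r, c)] with [r + c] odd form a minimal vertex cover. Adding the
    cells [(2, 0)], [(1, 1)], [(2, 2)] to it makes [(2, 1)] redundant, and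
    removing [(2, 1)] leaves a minimal vertex cover again. At least two cells
    were added, as [(2, 2)] is missing only for [t = 1], and one was removed,
    so the two covers have different sizes. *)

Lemma vertex_coverP (G : sgraph) (C : {set G}) :
  reflect (forall u v : G, adj u v -> (u \in C) || (v \in C))
          (vertex_cover C).
Proof.
apply: (iffP forallP) => [covC u v uv | covC u].
  by move/forallP: (covC u) => /(_ v); rewrite uv.
by apply/forallP => v; apply/implyP; apply: covC.
Qed.

(** If [v] is a neighbour of [u] outside [C], only [u] covers the edge [uv], so no cover contained
    in [C] can omit [u]. *)
Lemma minimal_vertex_cover_private (G : sgraph) (C : {set G}) :
  vertex_cover C ->
  (forall u, u \in C -> exists2 v, adj u v & v \notin C) ->
  minimal_vertex_cover C.
Proof.
move=> covC privC; apply/minsetP; split=> // D /vertex_coverP covD sDC.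
apply/eqP; rewrite eqEsubset sDC; apply/subsetP => u /privC[v uv vC].
have := covD u v uv; case: (boolP (v \in D)) => [/(subsetP sDC)|_].
  by rewrite (negbTE vC).
by rewrite orbF.
Qed.

Section Grid.

Variable t : nat.

(** The vertices are numbered row by row, [t.+1] to a row. *)
Definition row_of (u : B2 t) : nat := (u : 'I__) %/ t.+1.
Definition col_of (u : B2 t) : nat := (u : 'I__) %% t.+1.

Lemma row_of_lt u : row_of u < 3.
Proof. by rewrite /row_of ltn_divLR //; have := ltn_ord u; lia. Qed.

Lemma col_of_lt u : col_of u < t.+1.
Proof. exact: ltn_pmod. Qed.

Lemma cell_lt r c : r < 3 -> c < t.+1 -> r * t.+1 + c < 3 * t + 3.
Proof. by case: r => [|[|[|r]]] //; lia. Qed.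

Definition grid_adj (r c r' c' : nat) : bool :=
  (r == r') && ((c' == c.+1) || (c == c'.+1))
  || (c == c') && ((r' == r.+1) || (r == r'.+1)).

Lemma adjE (u v : B2 t) :
  adj u v = grid_adj (row_of u) (col_of u) (row_of v) (col_of v).
Proof.
have := (row_of_lt u, row_of_lt v, col_of_lt u, col_of_lt v).
have := (divn_eq (u : 'I__) t.+1, divn_eq (v : 'I__) t.+1).
rewrite /= /B2_adj /B2_arc -/(row_of u) -/(row_of v) -/(col_of u) -/(col_of v).
move=> [-> ->]; rewrite /grid_adj.
move: (row_of u) (row_of v) (col_of u) (col_of v) => r s c d.
case=> [[[r3 s3] ct] dt].
(* With numerals for the rows, the products with [t.+1] become linear. The excluded labels [t + 1]
   and [2 * t + 2] are the ends of rows 0 and 1. *)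
by case: r r3 => [|[|[|r]]] // _; case: s s3 => [|[|[|s]]] // _; lia.
Qed.

Lemma cell_exists r c : r < 3 -> c < t.+1 ->
  exists2 u : B2 t, row_of u = r & col_of u = c.
Proof.
move=> r3 ct; exists (Ordinal (cell_lt _ _ r3 ct) : B2 t).
  by rewrite /row_of /= divnMDl // divn_small // addn0.
by rewrite /col_of /= modnMDl modn_small.
Qed.

Lemma cell_inj (u v : B2 t) :
  row_of u = row_of v -> col_of u = col_of v -> u = v.
Proof.
move=> eq_r eq_c; apply: val_inj => /=.
by rewrite (divn_eq u t.+1) (divn_eq v t.+1) -/(row_of u) eq_r -/(col_of u) eq_c.
Qed.

Definition cells (P : nat -> nat -> bool) : {set B2 t} :=
  [set u : B2 t | P (row_of u) (col_of u)].

Lemma cells_minimal (P : nat -> nat -> bool) :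
  (forall r c r' c', r < 3 -> r' < 3 -> grid_adj r c r' c' ->
     P r c || P r' c') ->
  (forall r c, r < 3 -> c < t.+1 -> P r c ->
     exists r' c', [&& r' < 3, c' < t.+1, grid_adj r c r' c' & ~~ P r' c']) ->
  minimal_vertex_cover (cells P).
Proof.
move=> covP privP; apply: minimal_vertex_cover_private.
  apply/vertex_coverP => u v; rewrite adjE !inE.
  by apply: covP; apply: row_of_lt.
move=> u; rewrite inE => /(privP _ _ (row_of_lt u) (col_of_lt u)).
case=> r [c /and4P[r3 ct adj_rc NPrc]].
have [v rv cv] := cell_exists _ _ r3 ct.
by exists v; rewrite ?adjE ?inE rv cv.
Qed.

Definition checker (r c : nat) : bool := odd (r + c).

(** The listed cells are all the possible neighbours of [(2, 1)]. *)
Definition modified_checker (r c : nat) : bool :=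
  ((r, c) != (2, 1)) &&
  (checker r c || ((r, c) \in [:: (2, 0); (1, 1); (2, 2)])).

Lemma checker_minimal : minimal_vertex_cover (cells checker).
Proof.
apply: cells_minimal => [r c r' c' _ _|r c r3 ct odd_rc].
  rewrite /grid_adj /checker => /orP[] /andP[/eqP-> /orP[] /eqP->];
  by rewrite ?addnS ?addSn /=; case: odd.
(* A vertical neighbour: row 1 from rows 0 and 2, row 0 from row 1. It has the opposite parity. *)
exists (r != 1 : nat); exists c.
move: odd_rc; rewrite /checker /grid_adj ct eqxx.
by case: r r3 => [|[|[|r]]] // _ /=; case: odd.
Qed.

Hypothesis t_gt0 : 0 < t.

Lemma modified_checker_minimal : minimal_vertex_cover (cells modified_checker).
Proof.
apply: cells_minimal => [r c r' c'|r c].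
  (* Only columns 0, 1 and 2 differ from the checkerboard; the others share one case. *)
  case: r => [|[|[|r]]] // _; case: r' => [|[|[|r']]] // _;
  case: c => [|[|[|c]]]; case: c' => [|[|[|c']]] //;
  rewrite /grid_adj /modified_checker /checker !inE !xpair_eqE /= ?orbF ?andbF
          ?andbT //=; lia.
move=> r3 ct; have [|not_special] :=
  boolP ((r, c) \in [:: (2, 0); (1, 1); (2, 2)]).
  (* The removed cell [(2, 1)] is the uncovered neighbour of each added cell. *)
  rewrite !inE !xpair_eqE => special _; exists 2; exists 1.
  by rewrite /grid_adj /=; lia.
rewrite /modified_checker (negbTE not_special) orbF => /andP[not21 odd_rc].
(* The vertical neighbour serves again, except for [(0, 1)]: the cell [(1, 1)] below it was added,
   so [(0, 0)] is taken instead. *)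
exists (if (r, c) == (0, 1) then 0 else (r != 1) : nat).
exists (if (r, c) == (0, 1) then 0 else c).
move: ct not_special not21 odd_rc; rewrite /grid_adj /checker.
by case: r r3 => [|[|[|r]]] // _; case: c => [|[|[|c]]] //= ct;
  rewrite ?inE ?xpair_eqE //= ?ct ?eqxx //=; case: odd.
Qed.

Lemma card_checker_lt : #|cells checker| < #|cells modified_checker|.
Proof.
have [a ra ca] := cell_exists 2 0 isT (ltn0Sn t).
have [b rb cb] := cell_exists 1 1 isT t_gt0.
have [d rd cd] := cell_exists 2 1 isT t_gt0.
have ab : a != b by apply/eqP => eq_ab; move: ra; rewrite eq_ab rb.
have dC : d \in cells checker by rewrite inE rd cd.
have aC : a \notin cells checker :\ d by rewrite !inE ra ca andbF.
have bC : b \notin a |: cells checker :\ d.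
  by rewrite !inE rb cb andbF orbF eq_sym.
rewrite (cardsD1 d) dC add1n.
(* Exchanging [d] for [a] and [b] gains one cell and stays inside the modified cover; [(2, 2)],
   which may not exist, is left out. *)
have <- : #|b |: (a |: cells checker :\ d)| = #|cells checker :\ d|.+2.
  by rewrite cardsU1 bC cardsU1 aC.
apply: subset_leq_card; apply/subsetP => u; rewrite !inE.
case/or3P=> [/eqP->|/eqP->|/andP[ud odd_u]].
- by rewrite rb cb.
- by rewrite ra ca.
rewrite /modified_checker odd_u andbT xpair_eqE.
apply: contra ud => /andP[/eqP ru /eqP cu].
by apply/eqP/cell_inj; rewrite ?ru ?cu.
Qed.

End Grid.

Theorem theorem3p8 (t : nat) (t_gt0 : 0 < t) : ~ unmixed (B2 t).
Proof.
move=> /(_ _ _ (checker_minimal t) (modified_checker_minimal t t_gt0)) eq_card.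
by have := card_checker_lt t t_gt0; rewrite eq_card ltnn.
Qed.
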